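(* Let $G=(V,E)$ be a connected graph on $n$ vertices with vertex set $V=\{v_1,\ldots,v_n\}$, and let $d_{ij}=d_G(v_i,v_j)$ denote the distance between $v_i$ and $v_j$. Then $$\rho^{\mathcal{D}}(G)\leq \max_{1\leq i\leq n}\sqrt{(n-1)\sum_{k=1}^n d_{ki}^2}.$$ If equality holds, then $\sum_{k=1}^n d_{ki}^2=\sum_{k=1}^n d_{kj}^2$ for any $i,j\in\{1,2,\ldots,n\}$.
   Context: Graphs are finite, simple and undirected. The distance $d_G(u,v)$ is the length of a shortest path connecting $u$ and $v$ in $G$. The distance matrix of $G$ is the $n\times n$ matrix $\mathcal{D}(G)=(d_{ij})$ with $d_{ij}=d_G(v_i,v_j)$. The distance spectral radius $\rho^{\mathcal{D}}(G)$ is the spectral radius (largest modulus of an eigenvalue) of $\mathcal{D}(G)$. *)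

(* Defs.v *)
From HB Require Import structures.
From mathcomp Require Import all_boot all_order all_algebra.
From mathcomp Require Import complex.

Set Implicit Arguments.
Unset Strict Implicit.
Unset Printing Implicit Defensive.

Import Order.TTheory GRing.Theory Num.Theory.
Local Open Scope ring_scope.

Record sgraph (T : finType) := SGraph {
  adj : rel T;
  adj_sym : symmetric adj;
  adj_irrefl : irreflexive adj }.

Definition connected (T : finType) (G : sgraph T) : bool :=
  (0 < #|T|)%N && [forall x, forall y, connect (adj G) x y].

Definition has_walk (T : finType) (G : sgraph T) (x y : T) (m : nat) : bool :=
  [exists p : m.-tuple T, path (adj G) x p && (last x p == y)].

(* The least m such that some walk of length m joins x to y. A shortest walk
   repeats no vertex, so it is a shortest path and its length is below #|T|;
   if x and y are not connected, the value is the junk value #|T|. *)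
Definition gdist (T : finType) (G : sgraph T) (x y : T) : nat :=
  find (has_walk G x y) (iota 0 #|T|).

Lemma gdistP (T : finType) (G : sgraph T) (x y : T) :
  connect (adj G) x y ->
  (exists p, [/\ path (adj G) x p, uniq (x :: p), last x p = y
               & size p = gdist G x y]) /\
  (forall p, path (adj G) x p -> last x p = y -> (gdist G x y <= size p)%N).
Proof.
have walkP p : path (adj G) x p -> last x p = y -> has_walk G x y (size p).
  by move=> pp lp; apply/existsP; exists (in_tuple p); rewrite /= pp lp eqxx.
have short p : path (adj G) x p -> last x p = y ->
    exists q, [/\ path (adj G) x q, uniq (x :: q), last x q = y,
                  (size q <= size p)%N & (size q < #|T|)%N].
  move=> pp lp; case: (shortenP pp) lp => q pq uq sq lq; exists q; split=> //.
    by apply: uniq_leq_size => //; case/andP: uq.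
  by move/card_uniqP: uq => /= <-; apply: max_card.
have min p : path (adj G) x p -> last x p = y -> (gdist G x y <= size p)%N.
  move=> pp lp; case: (short p pp lp) => q [pq _ lq sq qT].
  rewrite leqNgt; apply/negP => lt; move: (leq_ltn_trans sq lt) => lt'.
  move: (before_find 0%N lt'); rewrite nth_iota // add0n.
  by rewrite walkP.
case/connectP=> p pp /esym lp; split=> //.
case: (short p pp lp) => q [pq _ lq _ qT].
have lt : (gdist G x y < #|T|)%N by apply: leq_ltn_trans (min q pq lq) qT.
have : has (has_walk G x y) (iota 0 #|T|) by rewrite has_find size_iota.
move/(nth_find 0%N); rewrite -/(gdist G x y) nth_iota // add0n.
case/existsP=> t /andP[pt /eqP lt'].
case: (short t pt lt') => r [pr ur lr sr _]; exists r; split=> //.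
by apply/eqP; rewrite eqn_leq min // andbT -[leqRHS](size_tuple t).
Qed.

Definition distance_matrix (R : pzSemiRingType) n (G : sgraph 'I_n) : 'M[R]_n :=
  \matrix_(i, j) (gdist G i j)%:R.

Definition complex_eigenvalues (R : rcfType) n (A : 'M[R]_n) : seq R[i] :=
  sval (closed_field_poly_normal
          (char_poly (map_mx (real_complex R) A))).

Definition spectral_radius (R : rcfType) n (A : 'M[R]_n) : R :=
  \big[Num.max/0]_(z <- complex_eigenvalues A) ComplexField.Normc.normc z.

Lemma mem_complex_eigenvalues (R : rcfType) n (A : 'M[R]_n) (z : R[i]) :
  (z \in complex_eigenvalues A) = eigenvalue (map_mx (real_complex R) A) z.
Proof.
rewrite eigenvalue_root_char /complex_eigenvalues.
case: closed_field_poly_normal => r /= ->.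
by rewrite (monicP (char_poly_monic _)) scale1r root_prod_XsubC.
Qed.

Lemma spectral_radiusP (R : rcfType) n (A : 'M[R]_n) : (0 < n)%N ->
  (exists2 z, eigenvalue (map_mx (real_complex R) A) z
            & ComplexField.Normc.normc z = spectral_radius A) /\
  (forall z, eigenvalue (map_mx (real_complex R) A) z ->
     ComplexField.Normc.normc z <= spectral_radius A).
Proof.
move=> n0; split; last first.
  move=> z; rewrite -mem_complex_eigenvalues => zr.
  by rewrite /spectral_radius; apply: le_bigmax_seq.
have : (0 < size (complex_eigenvalues A))%N.
  rewrite /complex_eigenvalues; case: closed_field_poly_normal => r /= Er.
  have := size_char_poly (map_mx (real_complex R) A).
  rewrite Er (monicP (char_poly_monic _)) scale1r size_prod_XsubC.
  by case=> ->.
rewrite /spectral_radius => s0.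
suff [z zs <-] : exists2 z, z \in complex_eigenvalues A &
    ComplexField.Normc.normc z = \big[Num.max/0]_(z <- complex_eigenvalues A)
      ComplexField.Normc.normc z.
  by exists z => //; rewrite -mem_complex_eigenvalues.
elim: (complex_eigenvalues A) s0 => // a s IH _; rewrite big_cons.
have a0 : 0 <= ComplexField.Normc.normc a by case: a => ? ?; apply: sqrtr_ge0.
case: s IH => [|b s] IH.
  by exists a; rewrite ?mem_head // big_nil; rewrite max_l.
case: (IH isT) => z zs Ez; rewrite -Ez.
case: (leP (ComplexField.Normc.normc a) (ComplexField.Normc.normc z)) => _.
  by exists z; rewrite // inE zs orbT.
by exists a; rewrite ?mem_head.
Qed.

(* Main.v *)
Require Import Defs.
From HB Require Import structures.
From mathcomp Require Import all_boot all_order all_algebra.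
From mathcomp Require Import complex.
From mathcomp Require Import ring lra.

Import Order.TTheory GRing.Theory Num.Theory.
Local Open Scope ring_scope.

(** Let [z] be an eigenvalue of a matrix [A] with zero diagonal, [v] an
    eigenvector, [x k = |v k|^2] and [S j] the sum of the squared moduli in
    column [j] of [A].  As the diagonal vanishes, the [j]-th eigenvalue equation
    expresses [z * v j] through the other coordinates of [v] only, so that
    Cauchy-Schwarz gives [|z|^2 * x j <= S j * \sum_(k != j) x k]
    ([eigenvector_coord_bound]).  Summing over [j] counts every [x k] exactly
    [n - 1] times, whence [|z|^2 <= (n - 1) * max S] ([averaging_bound]): the
    factor [n - 1] instead of [n] comes from the zero diagonal.

    If equality holds, a column with [S j < max S] can only be tolerated when
    [\sum_(k != j) x k = 0], that is when [v] is supported at [j]; but then the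
    coordinate inequality at [j] forces [z = 0], so [max S = 0], which is absurd
    as [S j >= 0] ([averaging_equality]).  The argument applies to every real matrix with
    zero diagonal ([spectral_radius_zero_diag]). *)

Section Averaging.
Variables (R : realFieldType) (n : nat) (x c : 'I_n -> R) (r b : R).
Hypothesis x_ge0 : forall j, 0 <= x j.
Hypothesis x_gt0 : 0 < \sum_j x j.
Hypothesis coord_bound : forall j, r * x j <= c j * \sum_(k | k != j) x k.
Hypothesis c_le : forall j, (n%:R - 1) * c j <= b.

Lemma sum_others (j : 'I_n) : \sum_(k | k != j) x k = \sum_k x k - x j.
Proof. by rewrite [in RHS](bigD1 j) //= addrAC subrr add0r. Qed.

Lemma sum_sum_others :
  \sum_j \sum_(k | k != j) x k = (n%:R - 1) * \sum_k x k.
Proof.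
under eq_bigr do rewrite sum_others.
by rewrite sumrB sumr_const card_ord mulrBl mul1r mulr_natl.
Qed.

(** The coordinate inequalities, summed over [j] and read as a comparison of
    slacks: each term on the left is nonnegative, which yields [r <= b], and all
    of them vanish when [r = b]. *)
Lemma weighted_slack (n_gt1 : (1 < n)%N) :
  \sum_j (b - (n%:R - 1) * c j) * (\sum_(k | k != j) x k)
    <= (b - r) * ((n%:R - 1) * \sum_j x j).
Proof.
have n1 : 0 < n%:R - 1 :> R by rewrite subr_gt0 ltr1n.
under eq_bigr do rewrite mulrBl.
rewrite sumrB -mulr_sumr sum_sum_others [leRHS]mulrBl lerD2l lerN2.
rewrite [leLHS]mulrCA ![in leLHS]mulr_sumr; apply: ler_sum => j _.
by rewrite -mulrA ler_pM2l.
Qed.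

Lemma slack_ge0 j : 0 <= (b - (n%:R - 1) * c j) * (\sum_(k | k != j) x k).
Proof. by rewrite mulr_ge0 ?subr_ge0 ?sumr_ge0. Qed.

Lemma averaging_bound (n_gt1 : (1 < n)%N) : r <= b.
Proof.
have n1 : 0 < n%:R - 1 :> R by rewrite subr_gt0 ltr1n.
rewrite -subr_ge0 -(pmulr_lge0 _ (mulr_gt0 n1 x_gt0)).
by apply: le_trans (weighted_slack n_gt1); apply: sumr_ge0 => j _; apply: slack_ge0.
Qed.

(** If [r = b] every slack term vanishes; a column that is strictly below the
    maximum must then carry the whole mass of [x]. *)
Lemma averaging_equality (n_gt1 : (1 < n)%N) (c_ge0 : forall j, 0 <= c j) :
  r = b -> forall j, (n%:R - 1) * c j = b.
Proof.
move=> rb j; have n1 : 0 < n%:R - 1 :> R by rewrite subr_gt0 ltr1n.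
have /eqP : (b - (n%:R - 1) * c j) * (\sum_(k | k != j) x k) = 0.
  apply/eqP; rewrite eq_le slack_ge0 andbT.
  have := weighted_slack n_gt1; rewrite rb subrr mul0r; apply: le_trans.
  by rewrite [leRHS](bigD1 j) //= lerDl sumr_ge0 // => k _; apply: slack_ge0.
rewrite mulf_eq0 subr_eq0 => /orP[/eqP // | /eqP others0].
have := coord_bound j; rewrite others0 mulr0.
have -> : x j = \sum_k x k by move: others0; rewrite sum_others; lra.
rewrite pmulr_lle0 // rb => b_le0.
apply/eqP; rewrite eq_le c_le /= (le_trans b_le0) //.
by rewrite mulr_ge0 // ltW.
Qed.

End Averaging.

(** Lagrange's identity: the difference of the two sides is half of
    [\sum_i \sum_j (a i * b j - a j * b i)^2]. *)
Lemma cauchy_schwarz_sum (R : realFieldType) (I : finType) (P : pred I)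
    (a b : I -> R) :
  (\sum_(i | P i) a i * b i) ^+ 2
    <= (\sum_(i | P i) a i ^+ 2) * (\sum_(i | P i) b i ^+ 2).
Proof.
have prodE f g : (\sum_(i | P i) f i) * (\sum_(i | P i) g i)
    = \sum_(i | P i) \sum_(j | P j) f i * g j :> R.
  by rewrite mulr_suml; apply: eq_bigr => i _; rewrite mulr_sumr.
have : 0 <= \sum_(i | P i) \sum_(j | P j) (a i * b j - a j * b i) ^+ 2.
  by apply: sumr_ge0 => i _; apply: sumr_ge0 => j _; apply: sqr_ge0.
have -> : \sum_(i | P i) \sum_(j | P j) (a i * b j - a j * b i) ^+ 2
    = (\sum_(i | P i) a i ^+ 2) * (\sum_(i | P i) b i ^+ 2)
      + (\sum_(i | P i) b i ^+ 2) * (\sum_(i | P i) a i ^+ 2)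
      - 2 * ((\sum_(i | P i) a i * b i) * (\sum_(i | P i) a i * b i)).
  rewrite !prodE mulr_sumr -big_split -sumrB /=; apply: eq_bigr => i _.
  rewrite mulr_sumr -big_split -sumrB /=; apply: eq_bigr => j _; ring.
by rewrite expr2; lra.
Qed.

Local Notation normc := ComplexField.Normc.normc.

Lemma normc_ge0 (R : rcfType) (z : R[i]) : 0 <= normc z.
Proof. by case: z => a b; apply: sqrtr_ge0. Qed.

(** The term [k = j] of the [j]-th eigenvalue equation disappears with [A j j];
    the rest is the triangle inequality followed by Cauchy-Schwarz. *)
Lemma eigenvector_coord_bound (R : rcfType) (n : nat) (A : 'M[R]_n)
    (z : R[i]) (v : 'rV[R[i]]_n) (j : 'I_n) :
  A j j = 0 -> v *m map_mx (real_complex R) A = z *: v ->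
  normc z ^+ 2 * normc (v 0 j) ^+ 2
    <= (\sum_k A k j ^+ 2) * \sum_(k | k != j) normc (v 0 k) ^+ 2.
Proof.
move=> Ajj /(congr1 (fun w : 'rV_n => w 0 j)); rewrite !mxE => vA.
have normcE (w : R[i]) : (normc w)%:C%C = `|w| by [].
rewrite (bigD1 j) //= Ajj expr0n add0r.
have le1 : normc z * normc (v 0 j) <= \sum_(k | k != j) `|A k j| * normc (v 0 k).
  rewrite -ComplexField.Normc.normcM -vA (bigD1 j) //= mxE Ajj mulr0 add0r.
  rewrite -lecR normcE rmorph_sum /=.
  apply: le_trans (ler_norm_sum _ _ _) _; apply: ler_sum => k _.
  by rewrite rmorphM /= normcE mxE normrM mulrC [`|_%:C%C|]normc_def /= expr0n addr0 sqrtr_sqr.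
rewrite -exprMn; apply: le_trans (_ : _ <= _ ^+ 2) _.
  apply: lerXn2r le1; rewrite ?nnegrE ?mulr_ge0 ?sumr_ge0 ?normc_ge0 // => k _.
  by rewrite mulr_ge0 ?normc_ge0.
apply: le_trans (cauchy_schwarz_sum _ _ _ _ _) _.
by under [X in X * _ <= _]eq_bigr do rewrite real_normK ?num_real //.
Qed.

Lemma gdistxx (n : nat) (G : sgraph 'I_n) (i : 'I_n) : gdist G i i = 0%N.
Proof.
have [_ /(_ [::] isT erefl)] := gdistP (connect0 (adj G) i).
by rewrite leqn0 => /eqP.
Qed.

Lemma spectral_radius_zero_diag (R : rcfType) (n : nat) (A : 'M[R]_n) :
  (0 < n)%N -> (forall i, A i i = 0) ->
  let S (i : 'I_n) : R := \sum_(k < n) A k i ^+ 2 in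
  let bound : R := \big[Num.max/0]_(i < n) Num.sqrt ((n%:R - 1) * S i) in
  spectral_radius A <= bound /\
  (spectral_radius A = bound -> forall i j : 'I_n, S i = S j).
Proof.
move=> n_gt0 A0 S bound.
have [[z /eigenvalueP[v vA v0] <-] _] := spectral_radiusP A n_gt0.
have S_ge0 j : 0 <= S j by apply: sumr_ge0 => k _; apply: sqr_ge0.
have bound_ge0 : 0 <= bound by apply: bigmax_ge_id.
have n1_ge0 : 0 <= n%:R - 1 :> R by rewrite subr_ge0 ler1n.
have S_le j : (n%:R - 1) * S j <= bound ^+ 2.
  rewrite -[leLHS]sqr_sqrtr ?mulr_ge0 //.
  by rewrite lerXn2r ?nnegrE ?sqrtr_ge0 //; apply: le_bigmax_cond.
pose x j := normc (v 0 j) ^+ 2.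
have x_ge0 j : 0 <= x j by apply: sqr_ge0.
have x_gt0 : 0 < \sum_j x j.
  rewrite lt_neqAle sumr_ge0 // andbT eq_sym psumr_eq0 //.
  apply: contra v0 => /allP x0; apply/eqP/rowP => j; rewrite mxE.
  apply: ComplexField.Normc.eq0_normc; apply/eqP.
  by have := x0 j (mem_index_enum j); rewrite /= sqrf_eq0.
have coord j : normc z ^+ 2 * x j <= S j * \sum_(k | k != j) x k.
  exact: eigenvector_coord_bound.
have [n_le1|n_gt1] := leqP n 1.
  (* One vertex: the coordinate inequality has an empty right-hand side. *)
  have I1 (i j : 'I_n) : i = j.
    have I0 (k : 'I_n) : val k = 0%N.
      by apply/eqP; rewrite -leqn0 -ltnS (leq_trans (ltn_ord k)).
    by apply: val_inj; rewrite !I0.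
  split=> [|_ i j]; last by rewrite (I1 i j).
  suff -> : normc z = 0 by [].
  pose j := Ordinal n_gt0.
  have := coord j; rewrite big_pred0 => [|k]; last by rewrite (I1 k j) eqxx.
  rewrite (_ : x j = \sum_k x k); last first.
    by rewrite (bigD1 j) //= big_pred0 ?addr0 // => k; rewrite (I1 k j) eqxx.
  rewrite mulr0 pmulr_lle0 // => z2.
  by apply/eqP; rewrite -sqrf_eq0 eq_le z2 sqr_ge0.
split=> [|z_eq i j].
  rewrite -(ler_pXn2r (ltn0Sn 1)) ?nnegrE ?normc_ge0 //.
  exact: (averaging_bound _ _ x S).
have eqS := averaging_equality R n x S _ _ x_ge0 x_gt0 coord S_le n_gt1 S_ge0
  (congr1 (fun t => t ^+ 2) z_eq).
have n1 : n%:R - 1 != 0 :> R by rewrite subr_eq0 pnatr_eq1 gtn_eqF.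
by apply: (mulfI n1); rewrite !eqS.
Qed.

Theorem theorem3p6 (R : rcfType) (n : nat) (G : sgraph 'I_n)
    (hG : connected G) :
  let rho : R := spectral_radius (distance_matrix R G) in
  let S (i : 'I_n) : R := \sum_(k < n) (gdist G k i)%:R ^+ 2 in
  let bound : R := \big[Num.max/0]_(i < n) Num.sqrt ((n%:R - 1) * S i) in
  rho <= bound /\ (rho = bound -> forall i j : 'I_n, S i = S j).
Proof.
move=> rho S bound.
have n_gt0 : (0 < n)%N by case/andP: hG; rewrite card_ord.
have SE i : \sum_(k < n) distance_matrix R G k i ^+ 2 = S i.
  by apply: eq_bigr => k _; rewrite mxE.
have diag0 i : distance_matrix R G i i = 0 by rewrite mxE gdistxx.
have [] := spectral_radius_zero_diag R n _ n_gt0 diag0; rewrite -/rho.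
under eq_bigr do rewrite SE.
by rewrite -/bound => le_b eq_b; split=> // /eq_b eqS i j; rewrite -!SE.
Qed.
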